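(* Let $\rho(t)=\log(1+e^t)$, $\ell(t)=\log(1+e^{-t})$, $\kappa_*>0$ and $r_*>0$. Consider the following two systems of equations. (LOO) In the unknowns $(\lambda_1,\alpha_1,\sigma)$, $\lambda_1>0$, $\alpha_1,\sigma\in\mathbb R$: $$\alpha_1^2=\frac{1}{\kappa_*^2}\mathbb E\Big[2\rho'(Q_1)\big(\lambda_1\rho'(\mathrm{Prox}_\rho(Q_2;\lambda_1))\big)^2\Big],$$ $$0=\mathbb E\big[\rho'(Q_1)\,Q_1\,\lambda_1\rho'(\mathrm{Prox}_\rho(Q_2;\lambda_1))\big],$$ $$1-\kappa_*=\mathbb E\Big[\frac{2\rho'(Q_1)}{1+\lambda_1\rho''(\mathrm{Prox}_\rho(Q_2;\lambda_1))}\Big],$$ where $$(Q_1,Q_2)\sim\mathcal N\left(\mathbf 0,\begin{bmatrix} r_*^2&-\sigma r_*^2\\-\sigma r_*^2&\sigma^2r_*^2+\alpha_1^2\kappa_*\end{bmatrix}\right).$$ (CGMT) In the unknowns $(\lambda_2,\alpha_2,\mu)$, $\lambda_2>0$, $\alpha_2,\mu\in\mathbb R$: $$0=\mathbb E\big[V\ell'(\mathrm{Prox}_\ell(\alpha_2Z+\mu V;\lambda_2))\big],$$ $$\alpha_2^2\kappa_*=\lambda_2^2\,\mathbb E\big[(\ell'(\mathrm{Prox}_\ell(\alpha_2Z+\mu V;\lambda_2)))^2\big],$$ $$\kappa_*=\lambda_2\,\mathbb E\Big[\frac{\ell''(\mathrm{Prox}_\ell(\alpha_2Z+\mu V;\lambda_2))}{1+\lambda_2\ell''(\mathrm{Prox}_\ell(\alpha_2Z+\mu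 V;\lambda_2))}\Big],$$ where $Z\sim\mathcal N(0,1)$ and $V=Z_1Y_{r_*}$, with $Z_1\sim\mathcal N(0,1)$, $(Z_1,Y_{r_*})$ independent of $Z$, and, conditionally on $Z_1$, $Y_{r_*}$ equal to $+1$ with probability $\rho'(r_*Z_1)$ and to $-1$ with probability $1-\rho'(r_*Z_1)$. Then the two systems are equivalent under the parameter transformation $$\alpha_1=\frac{\alpha_2}{\sqrt{\kappa_*}},\qquad \sigma=\frac{\mu}{r_*},\qquad \lambda_1=\lambda_2,$$ that is, $(\lambda_1,\alpha_1,\sigma)$ defined by these formulas solves (LOO) if and only if $(\lambda_2,\alpha_2,\mu)$ solves (CGMT).
   Context: For a convex function $f:\mathbb R\to\mathbb R$, $x\in\mathbb R$, $t>0$, the proximal operator is $\mathrm{Prox}_f(x;t)=\arg\min_{z\in\mathbb R}\{f(z)+\frac{1}{2t}(x-z)^2\}$. The two systems are the ''state equations'' obtained by the leave-one-out (LOO) method and by the convex Gaussian min-max theorem (CGMT) for logistic regression $\hat{\boldsymbol\beta}=\arg\min_{\boldsymbol\beta}\frac1n\sum_{i=1}^n\ell(y_i\mathbf x_i^T\boldsymbol\beta)$, where $\mathbb P(y_i=1\mid\mathbf x_i)=\rho'(\mathbf x_i^T\boldsymbol\beta^* )$, $y_i\in\{-1,1\}$, $\mathbf x_i$ i.i.d. $\mathcal N(0,\frac1dI_d)$, the entries of $\boldsymbol\beta^*$ have a law $\Pi$ with second moment $r_*^2=\mathbb E_{\beta\sim\Pi}\beta^2$, and $d/n\to\kappa_*$.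 *)

(* Defs.v *)
From HB Require Import structures.
From mathcomp Require Export all_boot all_order all_algebra.
From mathcomp Require Export all_classical all_reals all_analysis.
Set Implicit Arguments.
Unset Strict Implicit.
Unset Printing Implicit Defensive.
Import Order.TTheory GRing.Theory Num.Theory.
Import numFieldNormedType.Exports.
Local Open Scope classical_set_scope.
Local Open Scope ring_scope.

Definition rho {R : realType} (t : R) : R := ln (1 + expR t).

Definition ell {R : realType} (t : R) : R := ln (1 + expR (- t)).

(* The argmin is a singleton for convex f and t > 0; [xget] picks its element
   (the value 0 is returned only if the set of minimizers is empty). *)
Definition prox {R : realType} (f : R -> R) (x t : R) : R :=
  xget 0 [set z | forall w : R,
    f z + (2 * t)^-1 * (x - z) ^+ 2 <= f w + (2 * t)^-1 * (x - w) ^+ 2].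

Definition standard_normal d (T : measurableType d) (R : realType)
    (P : probability T R) (X : {RV P >-> R}) : Prop :=
  forall B : set R, measurable B ->
    P (X @^-1` B) = normal_prob (0 : R) 1 B.

(* (X, Y) has the law of A G, where A *m A^T = S and G is a standard normal
   vector of the plane. Unlike the definition by a density, this also covers
   singular covariance matrices S. *)
Definition centered_gaussian_pair d (T : measurableType d) (R : realType)
    (P : probability T R) (X Y : {RV P >-> R}) (S : 'M[R]_2) : Prop :=
  exists A : 'M[R]_2, A *m A^T = S /\
    forall B : set (R * R), measurable B ->
      P [set w | B (X w, Y w)] =
      (normal_prob (0 : R) 1 \x normal_prob (0 : R) 1)%E
        [set g : R * R | B (A ord0 ord0 * g.1 + A ord0 ord_max * g.2,
                            A ord_max ord0 * g.1 + A ord_max ord_max * g.2)].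

Definition indep_of_pair d (T : measurableType d) (R : realType)
    (P : probability T R) (X Y Z : {RV P >-> R}) : Prop :=
  forall (B : set (R * R)) (C : set R), measurable B -> measurable C ->
    P ([set w | B (X w, Y w)] `&` Z @^-1` C) =
    (P [set w | B (X w, Y w)] * P (Z @^-1` C))%E.

(* P(Y = 1 | X) = p(X) and P(Y = -1 | X) = 1 - p(X), by the defining property
   of conditional probabilities given X. *)
Definition cond_sign_law d (T : measurableType d) (R : realType)
    (P : probability T R) (X Y : {RV P >-> R}) (p : R -> R) : Prop :=
  forall B : set R, measurable B ->
    P (X @^-1` B `&` Y @^-1` [set 1]) =
      (\int[P]_(w in X @^-1` B) (p (X w))%:E)%E /\
    P (X @^-1` B `&` Y @^-1` [set -1]) =
      (\int[P]_(w in X @^-1` B) (1 - p (X w))%:E)%E.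

Definition LOO_cov {R : realType} (kappa r alpha sigma : R) : 'M[R]_2 :=
  \matrix_(i < 2, j < 2)
    if (i == ord0) && (j == ord0) then r ^+ 2
    else if (i == ord_max) && (j == ord_max)
      then sigma ^+ 2 * r ^+ 2 + alpha ^+ 2 * kappa
    else - (sigma * r ^+ 2).

(* [r] and [sigma] enter only through the law of (Q1, Q2). *)
Definition LOO_system d (T : measurableType d) (R : realType)
    (P : probability T R) (Q1 Q2 : {RV P >-> R})
    (kappa lambda alpha : R) : Prop :=
  [/\ 0 < lambda,
      (alpha ^+ 2)%:E = ((kappa ^+ 2)^-1%:E *
        'E_P[fun w => (2 * derive1 rho (Q1 w) *
               (lambda * derive1 rho (prox rho (Q2 w) lambda)) ^+ 2)%R])%E,
      0%E = 'E_P[fun w => (derive1 rho (Q1 w) * Q1 w *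
               (lambda * derive1 rho (prox rho (Q2 w) lambda)))%R]%E
    & (1 - kappa)%:E =
        'E_P[fun w => (2 * derive1 rho (Q1 w) /
               (1 + lambda * derive1n 2 rho (prox rho (Q2 w) lambda)))%R]%E].

Definition CGMT_system d (T : measurableType d) (R : realType)
    (P : probability T R) (Z V : T -> R)
    (kappa lambda alpha mu : R) : Prop :=
  let p w := prox ell (alpha * Z w + mu * V w) lambda in
  [/\ 0 < lambda,
      0%E = 'E_P[fun w => (V w * derive1 ell (p w))%R]%E,
      (alpha ^+ 2 * kappa)%:E =
        ((lambda ^+ 2)%:E * 'E_P[fun w => ((derive1 ell (p w)) ^+ 2)%R])%E
    & kappa%:E =
        (lambda%:E * 'E_P[fun w => (derive1n 2 ell (p w) /
                                   (1 + lambda * derive1n 2 ell (p w)))%R])%E].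

(* Main.v *)
From HB Require Import structures.
Require Import Defs.
From mathcomp Require Import measurable_realfun ring lra.
Import Order.TTheory GRing.Theory Num.Theory.
Import numFieldNormedType.Exports.
Local Open Scope classical_set_scope.
Local Open Scope ring_scope.

(** The two systems are the same three identities, written under two different
probability measures. With [s := rho'], every expectation of the first system
carries, up to a constant, the weight [2 * s (Q1)], and this weight is exactly the density, with
respect to the standard normal law, of [V = Z1 * Y] at [Q1 / r]: by the
symmetry of the normal law, [V] has density
[s (r v) + (1 - s (- r v)) = 2 * s (r v)] ([sign_tilted_normal]).

On the Gaussian side, [(Q1, Q2)] is a linear image [A g] of a standard normal
vector [g] of the plane with [A *m A^T] prescribed. Any two such [A] differ by
an orthogonal transformation of [g], which preserves the law of [g]; hence
[(Q1, Q2)] has the law of [(r x, - (mu x) - alpha2 y)] for a standard normal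
[(x, y)] ([ge0_integral_gaussian_pair]). Combining this with the density of [V]
and the independence of [(Z1, Y)] and [Z] gives, for every measurable [G],
  [E (2 s(Q1) G(Q1 / r, Q2)) = E (G(V, - (alpha2 Z + mu V)))],
which is [expectation_reweighting].

Since [ell t = rho (- t)], one has [prox ell x t = - prox rho (- x) t]
([prox_ell]), [ell' t = - rho' (- t)] and [ell'' t = rho'' (- t)]. So the
reweighted expectations are those of the second system, up to constant nonzero
factors for the first two equations, and, for the third one, up to the identity
[1 / (1 + lambda b) + lambda b / (1 + lambda b) = 1] ([equations_equiv]).

Two points need work. The laws are known on Borel sets, so the integrands must
be measurable: [prox rho] is, because it is nondecreasing. And the rotation
invariance of the standard normal law of the plane is obtained by writing a
rotation as a product of three shears, each of which preserves Lebesgue measure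
by Tonelli's theorem and translation invariance on the line. *)

(** * The logistic function *)

Section logistic.
Context {R : realType}.
Implicit Types t x z w : R.

Lemma onep_expR_gt0 t : 0 < 1 + expR t.
Proof. by rewrite addr_gt0 ?expR_gt0. Qed.

Lemma is_derive_onep_expR t : is_derive t 1 (fun x : R => 1 + expR x) (expR t).
Proof.
by have := @is_deriveD R R R (cst 1) expR t 1 _ _ (is_derive_cst _ _ _)
  (is_derive_expR t); rewrite add0r.
Qed.

Lemma is_derive_rho t : is_derive t 1 (@rho R) (expR t / (1 + expR t)).
Proof.
have := @is_derive1_comp R (@ln R) (fun x : R => 1 + expR x) t _ _
  (is_derive1_ln (onep_expR_gt0 t)) (is_derive_onep_expR t).
by rewrite mulrC.
Qed.

Lemma derive1_rho t : derive1 rho t = expR t / (1 + expR t).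
Proof. by rewrite derive1E; have [] := is_derive_rho t. Qed.

Lemma is_derive_derive1_rho t :
  is_derive t 1 (derive1 (@rho R)) (expR t / (1 + expR t) ^+ 2).
Proof.
have p : 1 + expR t != 0 by rewrite gt_eqF// onep_expR_gt0.
rewrite (_ : derive1 rho = fun x => expR x * (1 + expR x)^-1); last first.
  by apply/funext => x; exact: derive1_rho.
have := @is_deriveM R R expR _ t 1 _ _ (is_derive_expR t)
  (@is_deriveV _ (fun x : R => 1 + expR x) t _ 1 p (is_derive_onep_expR t)).
rewrite (_ : _ *: _ + _ *: _ = expR t / (1 + expR t) ^+ 2)//.
by rewrite /GRing.scale/=; field.
Qed.

Lemma derive2_rho t : derive1n 2 rho t = expR t / (1 + expR t) ^+ 2.
Proof.
by rewrite /derive1n/= derive1E; have [] := is_derive_derive1_rho t.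
Qed.

Lemma derive1_rho_ge0 (x : R) : 0 <= derive1 rho x.
Proof. by rewrite derive1_rho divr_ge0 ?expR_ge0// ltW ?onep_expR_gt0. Qed.

Lemma derive1_rhoN (x : R) : derive1 rho (- x) = 1 - derive1 rho x.
Proof.
rewrite !derive1_rho expRN; field.
by rewrite !gt_eqF ?expR_gt0 ?onep_expR_gt0// addrC onep_expR_gt0.
Qed.

Lemma derive2_rho_ge0 (x : R) : 0 <= derive1n 2 rho x.
Proof.
by rewrite derive2_rho divr_ge0 ?expR_ge0// exprn_ge0// ltW// onep_expR_gt0.
Qed.

(** The inverse is written as [exp (- ln _)], which reduces its measurability to
that of the exponential and the logarithm. *)
Lemma measurable_onepV {d} {T : measurableType d} (g : T -> R) :
  measurable_fun setT g -> (forall u, 0 <= g u) ->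
  measurable_fun setT (fun u => (1 + g u)^-1).
Proof.
move=> mg g0; rewrite (_ : (fun _ => _) = fun u => expR (- ln (1 + g u))).
  apply: measurableT_comp => //; apply: measurableT_comp => //.
  by apply: measurableT_comp; [exact: measurable_ln|exact: measurable_funD].
by apply/funext => u; rewrite expRN lnK// posrE ltr_pwDl.
Qed.

Lemma measurable_derive1_rho : measurable_fun [set: R] (derive1 (@rho R)).
Proof.
rewrite (_ : derive1 _ = fun x => expR x * (1 + expR x)^-1).
  by apply: measurable_funM => //; apply: measurable_onepV => // x; exact: expR_ge0.
by apply/funext => x; exact: derive1_rho.
Qed.

Lemma measurable_derive2_rho : measurable_fun [set: R] (derive1n 2 (@rho R)).
Proof.
rewrite (_ : derive1n 2 _ = fun x => expR x * (1 + expR x)^-1 ^+ 2).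
  apply: measurable_funM => //; apply: measurable_funX.
  by apply: measurable_onepV => // x; exact: expR_ge0.
by apply/funext => x; rewrite derive2_rho exprVn.
Qed.

Lemma derive1_comp_opp (f : R -> R) (a t : R) :
  is_derive (- t) 1 f a -> derive1 (fun x => f (- x)) t = - a.
Proof.
move=> fa; have := @is_derive1_comp R f -%R t _ _ fa (is_deriveNid t 1).
by rewrite derive1E mulrN1 => -[].
Qed.

Lemma derive1_ell t : derive1 ell t = - derive1 rho (- t).
Proof. by rewrite derive1_rho; exact: (derive1_comp_opp _ _ _ (is_derive_rho _)). Qed.

Lemma derive2_ell t : derive1n 2 ell t = derive1n 2 rho (- t).
Proof.
have := derive1_comp_opp _ _ _
  (@is_deriveN R R R _ _ _ _ (is_derive_derive1_rho (- t))).
rewrite opprK derive2_rho => <-; rewrite /derive1n/=; congr (derive1 _ t).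
by apply/funext => x; rewrite derive1_ell.
Qed.

End logistic.

(** * Proximal operators *)

Section prox.
Context {R : realType}.
Variable f : R -> R.
Hypothesis cf : continuous f.
Hypothesis f0 : forall x, 0 <= f x.
Implicit Types t x z w : R.

(** A minimizer exists because the objective is continuous and coercive: as [f]
is nonnegative, the quadratic term alone exceeds the value [f x] of the objective
at [x] once [w] leaves a large enough interval around [x]. *)
Lemma prox_min x t w : 0 < t ->
  f (prox f x t) + (2 * t)^-1 * (x - prox f x t) ^+ 2
  <= f w + (2 * t)^-1 * (x - w) ^+ 2.
Proof.
move=> t0; rewrite /prox.
suff [z zmin] : exists z, forall w : R,
    f z + (2 * t)^-1 * (x - z) ^+ 2 <= f w + (2 * t)^-1 * (x - w) ^+ 2.
  by case: xgetP => [y _ /(_ w)//|/(_ z)].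
have t2 : 0 < (2 * t)^-1 by rewrite invr_gt0 mulr_gt0.
pose F z : R := f z + (2 * t)^-1 * (x - z) ^+ 2.
(* This [M] satisfies [M ^ 2 >= M >= 2 t f(x)], so the objective is at least
   [M ^ 2 / (2 t) >= f x] outside [x - M, x + M]. *)
pose M := 1 + 2 * t * f x.
have M1 : 1 <= M by rewrite lerDl !mulr_ge0// ltW.
have cF : continuous F.
  move=> z; apply: cvgD; first exact: cf.
  apply: cvgM; first exact: cvg_cst.
  apply: (@cvg_comp _ _ _ (fun y => x - y) (fun y => y ^+ 2)) (@sqr_continuous _ _).
  by apply: cvgB; [exact: cvg_cst|exact: cvg_id].
have [|c _ cmin] := @EVT_min R F (x - M) (x + M) _ (continuous_subspaceT cF).
  lra.
exists c => w'.
have xin : x \in `[x - M, x + M] by rewrite in_itv/=; apply/andP; split; lra.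
have [w'in|w'out] := boolP (w' \in `[x - M, x + M]); first exact: cmin.
apply: (le_trans (cmin _ xin)).
rewrite /F subrr expr0n/= mulr0 addr0.
apply: (@le_trans _ _ ((2 * t)^-1 * M ^+ 2)).
  rewrite mulrC ler_pdivlMr ?mulr_gt0//.
  apply: (@le_trans _ _ M); first by rewrite /M; lra.
  by rewrite expr2 ler_peMr//; lra.
apply: (@le_trans _ _ ((2 * t)^-1 * (x - w') ^+ 2)); last by rewrite lerDr.
rewrite ler_pM2l//.
move: w'out; rewrite in_itv/= negb_and -!ltNge => /orP[] h; nra.
Qed.

(** Comparing the minimizer at [x] with the one at [y], and conversely, then
adding the two inequalities, makes the values of [f] cancel and leaves
[(y - x) * (prox f y t - prox f x t) >= 0]. *)
Lemma prox_nondecreasing t : 0 < t -> {homo prox f ^~ t : x y / x <= y}.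
Proof.
move=> t0 x y; rewrite le_eqVlt => /predU1P[->//|xy].
have t2 : 0 < (2 * t)^-1 by rewrite invr_gt0 mulr_gt0.
have := prox_min x t (prox f y t) t0; have := prox_min y t (prox f x t) t0.
set a := prox f x t; set b := prox f y t; set c := _^-1 => h1 h2.
have : c * ((y - b) ^+ 2 + (x - a) ^+ 2) <= c * ((y - a) ^+ 2 + (x - b) ^+ 2).
  by lra.
rewrite ler_pM2l// => h.
have : 0 <= (y - x) * (b - a) by nra.
by rewrite pmulr_rge0 ?subr_ge0// subr_gt0.
Qed.

Hypothesis cvx : forall x y, f ((x + y) / 2) <= (f x + f y) / 2.

(** The midpoint of two distinct minimizers would do strictly better, by
strict convexity of the quadratic term. *)
Lemma prox_unique x t z : 0 < t ->
  (forall w, f z + (2 * t)^-1 * (x - z) ^+ 2 <= f w + (2 * t)^-1 * (x - w) ^+ 2) ->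
  prox f x t = z.
Proof.
move=> t0 zmin.
have t2 : 0 < (2 * t)^-1 by rewrite invr_gt0 mulr_gt0.
have := prox_min x t ((prox f x t + z) / 2) t0.
have := zmin ((prox f x t + z) / 2).
set a := prox f x t; set c := _^-1 => h1 h2.
have h3 := cvx a z.
have : c * (a - z) ^+ 2 <= 0.
  have -> : c * (a - z) ^+ 2 = 2 * c * (x - a) ^+ 2 + 2 * c * (x - z) ^+ 2
     - 4 * c * (x - (a + z) / 2) ^+ 2 by field.
  lra.
rewrite pmulr_rle0// => h.
apply/eqP; rewrite -subr_eq0 -sqrf_eq0 eq_le h sqr_ge0//.
Qed.

End prox.

Section rho_prox.
Context {R : realType}.
Implicit Types t x z w : R.

Lemma rho_continuous : continuous (@rho R).
Proof.
move=> x; apply: (@continuous_comp _ _ _ (fun y : R => 1 + expR y) (@ln R)).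
  by apply: cvgD; [exact: cvg_cst|exact: continuous_expR].
exact: continuous_ln (onep_expR_gt0 x).
Qed.

Lemma rho_ge0 x : 0 <= rho x.
Proof. by rewrite ln_ge0// lerDl expR_ge0. Qed.

(** Since [rho] is the logarithm of [1 + exp], this is the inequality
[(1 + a b) ^ 2 <= (1 + a ^ 2) (1 + b ^ 2)] with [a = exp (x / 2)] and
[b = exp (y / 2)]. *)
Lemma rho_midpoint x y : rho ((x + y) / 2) <= (rho x + rho y) / 2.
Proof.
rewrite ler_pdivlMr// mulr_natr mulr2n /rho.
rewrite -!lnM ?posrE ?onep_expR_gt0// ler_ln ?posrE ?mulr_gt0 ?onep_expR_gt0//.
set a := expR (x / 2); set b := expR (y / 2).
have -> : expR ((x + y) / 2) = a * b by rewrite mulrDl expRD.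
have -> : expR x = a ^+ 2 by rewrite expr2 -expRD; congr expR; lra.
have -> : expR y = b ^+ 2 by rewrite expr2 -expRD; congr expR; lra.
have := sqr_ge0 (a - b); nra.
Qed.

(** Reflection [w |-> - w] exchanges the two minimization problems, so the
opposite of a minimizer of one is a minimizer of the other, and uniqueness
applies. *)
Lemma prox_ell x t : 0 < t -> prox ell x t = - prox rho (- x) t.
Proof.
move=> t0; rewrite -[LHS]opprK; congr (- _); apply/esym.
apply: (prox_unique rho rho_continuous rho_ge0 rho_midpoint _ _ _ t0).
have cell : continuous (@ell R).
  by move=> y; apply: (@continuous_comp _ _ _ -%R rho);
    [exact: opp_continuous|exact: rho_continuous].
have ell0 y : 0 <= @ell R y by exact: rho_ge0.
move=> w; have := prox_min ell cell ell0 x t (- w) t0.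
rewrite /ell/= opprK -!/(rho _).
have -> : (- x - - prox ell x t) ^+ 2 = (x - prox ell x t) ^+ 2 by ring.
by have -> : (x + w) ^+ 2 = (- x - w) ^+ 2 by ring.
Qed.

Lemma measurable_prox_rho t : 0 < t -> measurable_fun setT (fun x : R => prox rho x t).
Proof.
move=> t0; apply: nondecreasing_measurable => //.
exact: prox_nondecreasing rho_continuous rho_ge0 _ t0.
Qed.

End rho_prox.

(** * Integrals of functions of a random variable *)

Section transfer.
Local Open Scope ereal_scope.

Lemma ge0_integral_same_law_in {d1 d2 d} {T1 : measurableType d1}
    {T2 : measurableType d2} {T : measurableType d} {R : realType}
    (m1 : {measure set T1 -> \bar R}) (m2 : {measure set T2 -> \bar R})
    (X1 : T1 -> T) (X2 : T2 -> T) (D : set T) (f : T -> \bar R) :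
  measurable_fun setT X1 -> measurable_fun setT X2 -> measurable D ->
  (forall B, measurable B -> m1 (X1 @^-1` B) = m2 (X2 @^-1` B)) ->
  measurable_fun setT f -> (forall x, 0 <= f x) ->
  \int[m1]_(x in X1 @^-1` D) f (X1 x) = \int[m2]_(y in X2 @^-1` D) f (X2 y).
Proof.
move=> mX1 mX2 mD law mf f0; have mfD := measurable_funTS (D := D) mf.
have <- := ge0_integral_pushforward mX1 m1 mD mfD (fun y _ => f0 y).
have <- := ge0_integral_pushforward mX2 m2 mD mfD (fun y _ => f0 y).
by apply: eq_measure_integral => A mA _; exact: law.
Qed.

Lemma ge0_integral_same_law {d1 d2 d} {T1 : measurableType d1}
    {T2 : measurableType d2} {T : measurableType d} {R : realType}
    (m1 : {measure set T1 -> \bar R}) (m2 : {measure set T2 -> \bar R})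
    (X1 : T1 -> T) (X2 : T2 -> T) (f : T -> \bar R) :
  measurable_fun setT X1 -> measurable_fun setT X2 ->
  (forall B, measurable B -> m1 (X1 @^-1` B) = m2 (X2 @^-1` B)) ->
  measurable_fun setT f -> (forall x, 0 <= f x) ->
  \int[m1]_x f (X1 x) = \int[m2]_y f (X2 y).
Proof.
move=> mX1 mX2 law mf f0.
exact: (ge0_integral_same_law_in m1 m2 X1 X2 setT f mX1 mX2 measurableT law mf f0).
Qed.

(** A density [w] agrees almost everywhere with the Radon-Nikodym derivative,
for which the change of variables is known. *)
Lemma ge0_integral_density {d} {T : measurableType d} {R : realType}
    (mu : {sigma_finite_measure set T -> \bar R})
    (nu : {finite_measure set T -> \bar R}) (w : T -> R) (f : T -> \bar R) :
  measurable_fun setT w -> (forall x, (0 <= w x)%R) ->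
  (forall A, measurable A -> nu A = \int[mu]_(x in A) (w x)%:E) ->
  measurable_fun setT f -> (forall x, 0 <= f x) ->
  \int[nu]_x f x = \int[mu]_x ((w x)%:E * f x).
Proof.
move=> mw w0 nuE mf f0.
have numu : nu `<< mu.
  apply/null_content_dominatesP => A mA muA0; rewrite nuE//.
  by apply: null_set_integral => //; exact/measurable_EFinP/measurable_funTS.
rewrite -(Radon_Nikodym_SigmaFinite.change_of_variables numu f0)//.
have fi := Radon_Nikodym_SigmaFinite.f_integrable numu.
under [RHS]eq_integral do rewrite muleC.
apply: ae_eq_integral => //.
- by apply: emeasurable_funM => //; exact: measurable_int fi.
- by apply: emeasurable_funM => //; exact/measurable_EFinP.
apply: ae_eqe_mul2l; apply: integral_ae_eq => //; first exact/measurable_EFinP.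
by move=> E _ mE; rewrite -Radon_Nikodym_SigmaFinite.f_integral// nuE.
Qed.

(** The random variable [X] also serves, when it is the identity, to pass
between two copies of the real line equipped with differently presented Borel
sigma-algebras. *)
Lemma ge0_integral_law_density {d d'} {T : measurableType d}
    {T' : measurableType d'} {R : realType}
    (P : probability T' R) (mu : {sigma_finite_measure set T -> \bar R})
    (X : T' -> T) (w : T -> R) (f : T -> \bar R) :
  measurable_fun setT X -> measurable_fun setT w -> (forall x, (0 <= w x)%R) ->
  (forall A, measurable A -> P (X @^-1` A) = \int[mu]_(x in A) (w x)%:E) ->
  measurable_fun setT f -> (forall x, 0 <= f x) ->
  \int[P]_t f (X t) = \int[mu]_x ((w x)%:E * f x).
Proof.
move=> mX mw w0 law mf f0.
pose X' : {mfun T' >-> T} := HB.pack X (isMeasurableFun.Build _ _ _ _ X mX).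
rewrite -(ge0_integral_density mu (distribution P X') w f mw w0 law mf f0).
exact: (ge0_integral_same_law P (distribution P X') X id).
Qed.

End transfer.

Section lebesgue.
Context {R : realType}.
Local Notation leb := (@lebesgue_measure R).
Local Open Scope ereal_scope.

Lemma ge0_integral_translate (f : R -> \bar R) (a : R) :
  measurable_fun setT f -> (forall x, 0 <= f x) ->
  \int[leb]_x f (x + a)%R = \int[leb]_x f x.
Proof.
move=> mf f0.
pose tr (x : measurableTypeR R) : measurableTypeR R := (x + a)%R.
have mtr : measurable_fun setT tr by exact: measurable_funD.
apply: (ge0_integral_same_law leb leb tr id) => // B mB.
suff H : leb B = pushforward leb tr B by exact: esym H.
apply: lebesgue_measure_unique => // _ [[x y]] _ <-.
rewrite /= /pushforward [X in _ = lebesgue_measure X](_ : _ @^-1` _ =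
  `]x - a, y - a]%classic)%R; last first.
  by apply/seteqP; split => z/=; rewrite /tr !in_itv/= ltrBlDr lerBrDr.
rewrite !lebesgue_measure_itv/= !lte_fin ltrD2r; case: ifP => // _.
by rewrite -!EFinB; congr EFin; lra.
Qed.

Lemma ge0_integral_opp (f : R -> \bar R) :
  measurable_fun setT f -> (forall x, 0 <= f x) ->
  \int[leb]_x f (- x)%R = \int[leb]_x f x.
Proof.
move=> mf f0.
apply: (ge0_integral_same_law leb leb _ id) => // B mB.
exact: lebesgue_measureN.
Qed.

End lebesgue.

(** * Orthogonal invariance of the standard normal law of the plane *)

Section plane.
Context {R : realType}.
Local Notation leb := (@lebesgue_measure R).
Local Notation N := (normal_prob (0 : R) 1).
Local Notation phi := (normal_pdf (0 : R) 1).
Local Open Scope ereal_scope.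
Implicit Type f : R * R -> \bar R.

Lemma ge0_integral_shear1 f (t : R) : measurable_fun setT f ->
  (forall z, 0 <= f z) ->
  \int[leb \x leb]_z f (z.1 + t * z.2, z.2)%R = \int[leb \x leb]_z f z.
Proof.
move=> mf f0.
have mt : measurable_fun setT (fun z : R * R => (z.1 + t * z.2, z.2))%R.
  by apply: measurable_fun_pair => //; apply: measurable_funD => //;
    apply: measurable_funM.
rewrite fubini_tonelli2//; last exact: measurableT_comp mf mt.
rewrite [RHS]fubini_tonelli2; [|exact: mf|exact: f0].
apply: eq_integral => y _.
apply: (ge0_integral_translate (fun x => f (x, y)) (t * y)%R) => //.
exact: measurableT_comp mf (measurable_pair2 y).
Qed.

Lemma ge0_integral_shear2 f (t : R) : measurable_fun setT f ->
  (forall z, 0 <= f z) ->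
  \int[leb \x leb]_z f (z.1, z.2 + t * z.1)%R = \int[leb \x leb]_z f z.
Proof.
move=> mf f0.
have mt : measurable_fun setT (fun z : R * R => (z.1, z.2 + t * z.1))%R.
  by apply: measurable_fun_pair => //; apply: measurable_funD => //;
    apply: measurable_funM.
rewrite fubini_tonelli1//; last exact: measurableT_comp mf mt.
rewrite [RHS]fubini_tonelli1; [|exact: mf|exact: f0].
apply: eq_integral => x _.
apply: (ge0_integral_translate (fun y => f (x, y)) (t * x)%R) => //.
exact: measurableT_comp mf (measurable_pair1 x).
Qed.

Lemma ge0_integral_reflect2 f : measurable_fun setT f ->
  (forall z, 0 <= f z) ->
  \int[leb \x leb]_z f (z.1, - z.2)%R = \int[leb \x leb]_z f z.
Proof.
move=> mf f0.
have mt : measurable_fun setT (fun z : R * R => (z.1, - z.2))%R.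
  by apply: measurable_fun_pair => //; apply: measurableT_comp.
rewrite fubini_tonelli1//; last exact: measurableT_comp mf mt.
rewrite [RHS]fubini_tonelli1; [|exact: mf|exact: f0].
apply: eq_integral => x _.
apply: (ge0_integral_opp (fun y => f (x, y))) => //.
exact: measurableT_comp mf (measurable_pair1 x).
Qed.

Lemma ge0_integral_normal (f : R -> \bar R) : measurable_fun setT f ->
  (forall x, 0 <= f x) -> \int[N]_x f x = \int[leb]_x ((phi x)%:E * f x).
Proof.
move=> mf f0; apply: ge0_integral_density => //.
  exact: measurable_normal_pdf.
by move=> x; exact: normal_pdf_ge0.
Qed.

Lemma ge0_integral_normal2 f : measurable_fun setT f -> (forall z, 0 <= f z) ->
  \int[N \x N]_z f z =
  \int[leb \x leb]_z ((phi z.1 * phi z.2)%:E * f z).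
Proof.
move=> mf f0.
have mphi := measurable_normal_pdf (0:R) 1.
have phi0 (x : R) : 0 <= (phi x)%:E by rewrite lee_fin normal_pdf_ge0.
rewrite fubini_tonelli1// fubini_tonelli1//; last 2 first.
- apply: emeasurable_funM => //; apply/measurable_EFinP.
  by apply: measurable_funM; apply: measurableT_comp.
- by move=> z; rewrite mule_ge0// EFinM mule_ge0.
rewrite ge0_integral_normal//; last 2 first.
- exact: measurable_fun_fubini_tonelli_F.
- by move=> x; apply: integral_ge0.
apply: eq_integral => x _; rewrite /fubini_F/=.
have mfx : measurable_fun setT (fun y => f (x, y)).
  exact: measurableT_comp mf (measurable_pair1 x).
rewrite ge0_integral_normal// -ge0_integralZl//.
- by apply: eq_integral => y _; rewrite EFinM muleA.
- by apply: emeasurable_funM => //; exact/measurable_EFinP.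
- by move=> y _; rewrite mule_ge0.
Qed.

Lemma standard_normal_pdfE (x : R) :
  phi x = (normal_peak 1 * expR (- (x ^+ 2 / 2)))%R.
Proof. by rewrite normal_pdfE ?oner_neq0// /normal_fun subr0 mulNr expr1n. Qed.

Lemma normal_pdf2E (x y x' y' : R) : (x ^+ 2 + y ^+ 2 = x' ^+ 2 + y' ^+ 2 ->
  phi x * phi y = phi x' * phi y')%R.
Proof.
move=> h; rewrite !standard_normal_pdfE 2![(_ * expR _ * _)%R]mulrACA -!expRD.
by congr (_ * expR _)%R; lra.
Qed.

(** A rotation of cosine [c] and sine [s] is the composition of a shear of
ratio [- s / (1 + c)] along the first axis (minus the tangent of the half
angle), a shear of ratio [s] along the second one, and the first shear again.
Shears preserve Lebesgue measure and rotations preserve the density, a function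
of the distance to the origin. *)
Lemma ge0_integral_normal2_rotation_neqN1 f (c s : R) : measurable_fun setT f ->
  (forall z, 0 <= f z) -> (c ^+ 2 + s ^+ 2 = 1)%R -> (1 + c != 0)%R ->
  \int[N \x N]_z f (c * z.1 - s * z.2, s * z.1 + c * z.2)%R =
  \int[N \x N]_z f z.
Proof.
move=> mf f0 cs c1.
have mphi := measurable_normal_pdf (0:R) 1.
have mlin (a b : R) : measurable_fun setT (fun z : R * R => a * z.1 + b * z.2)%R.
  by apply: measurable_funD => //; apply: measurable_funM.
pose F z := (phi z.1 * phi z.2)%:E * f z.
have mF : measurable_fun setT F.
  apply: emeasurable_funM => //; apply/measurable_EFinP.
  by apply: measurable_funM; apply: measurableT_comp.
have F0 z : 0 <= F z by rewrite mule_ge0// lee_fin mulr_ge0// normal_pdf_ge0.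
rewrite ge0_integral_normal2//; last first.
  apply: measurableT_comp mf _; apply: measurable_fun_pair => //=.
  by under eq_fun do rewrite -mulNr; exact: mlin.
rewrite [RHS]ge0_integral_normal2//.
pose t := (- s / (1 + c))%R.
pose F1 z := F (z.1 + t * z.2, z.2)%R.
pose F2 z := F1 (z.1, z.2 + s * z.1)%R.
have mF1 : measurable_fun setT F1.
  apply: measurableT_comp mF _; apply: measurable_fun_pair => //=.
  by apply: measurable_funD => //; apply: measurable_funM.
have mF2 : measurable_fun setT F2.
  apply: measurableT_comp mF1 _; apply: measurable_fun_pair => //=.
  by apply: measurable_funD => //; apply: measurable_funM.
have S1 := ge0_integral_shear1 F t mF F0.
have S2 := ge0_integral_shear2 F1 s mF1 (fun z => F0 _).
have S3 := ge0_integral_shear1 F2 t mF2 (fun z => F0 _).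
apply: etrans (etrans S3 (etrans S2 S1)).
apply: eq_integral => -[x y] _; rewrite /F2 /F1 /F/=.
have tc : (t * (1 + c) = - s)%R by rewrite /t divfK.
have st : (s * t = c - 1)%R.
  by apply: (mulIf c1); rewrite -mulrA tc; move: cs; rewrite !expr2; lra.
have e1 : (y + s * (x + t * y) = s * x + c * y)%R.
  by transitivity (s * x + (1 + s * t) * y)%R; [ring|rewrite st; ring].
rewrite e1.
have -> : (x + t * y + t * (s * x + c * y) = c * x - s * y)%R.
  transitivity ((1 + s * t) * x + t * (1 + c) * y)%R; first by ring.
  by rewrite st tc; ring.
congr (_%:E * _); apply: normal_pdf2E.
transitivity ((c ^+ 2 + s ^+ 2) * (x ^+ 2 + y ^+ 2))%R; last by ring.
by rewrite cs mul1r.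
Qed.

Lemma ge0_integral_normal2_rotation f (c s : R) : measurable_fun setT f ->
  (forall z, 0 <= f z) -> (c ^+ 2 + s ^+ 2 = 1)%R ->
  \int[N \x N]_z f (c * z.1 - s * z.2, s * z.1 + c * z.2)%R =
  \int[N \x N]_z f z.
Proof.
move=> mf f0 cs; have [c1|] := eqVneq (1 + c)%R 0%R; last first.
  exact: ge0_integral_normal2_rotation_neqN1.
(* The half turn, whose half angle has no tangent, is two quarter turns. *)
have cE : c = (-1)%R by lra.
have sE : s = 0%R.
  by apply/eqP; rewrite -sqrf_eq0; apply/eqP; move: cs; rewrite cE; lra.
have u1 : (0 ^+ 2 + 1 ^+ 2 = 1 :> R)%R by ring.
have v1 : (1 + 0 != 0 :> R)%R by rewrite addr0 oner_neq0.
pose f1 z := f (0 * z.1 - 1 * z.2, 1 * z.1 + 0 * z.2)%R.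
have mf1 : measurable_fun setT f1.
  apply: measurableT_comp mf _; apply: measurable_fun_pair => //=.
    by apply: measurable_funB => //; apply: measurable_funM.
  by apply: measurable_funD => //; apply: measurable_funM.
have S1 := ge0_integral_normal2_rotation_neqN1 f 0%R 1%R mf f0 u1 v1.
have S2 := ge0_integral_normal2_rotation_neqN1 f1 0%R 1%R mf1 (fun z => f0 _) u1 v1.
rewrite -S1 -S2; apply: eq_integral => -[x y] _; rewrite /f1/= cE sE.
by congr (f (_, _)); ring.
Qed.

Lemma ge0_integral_normal2_reflect f : measurable_fun setT f ->
  (forall z, 0 <= f z) ->
  \int[N \x N]_z f (z.1, - z.2)%R = \int[N \x N]_z f z.
Proof.
move=> mf f0.
have mphi := measurable_normal_pdf (0:R) 1.
pose F z := (phi z.1 * phi z.2)%:E * f z.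
have mF : measurable_fun setT F.
  apply: emeasurable_funM => //; apply/measurable_EFinP.
  by apply: measurable_funM; apply: measurableT_comp.
have F0 z : 0 <= F z by rewrite mule_ge0// lee_fin mulr_ge0// normal_pdf_ge0.
rewrite ge0_integral_normal2//; last first.
  apply: measurableT_comp mf _; apply: measurable_fun_pair => //=.
  exact: measurableT_comp.
rewrite [RHS]ge0_integral_normal2//.
apply: etrans (ge0_integral_reflect2 F mF F0).
apply: eq_integral => -[x y] _; rewrite /F/=.
by congr (_%:E * _); apply: normal_pdf2E; rewrite sqrrN.
Qed.

Lemma ge0_integral_normal_opp (f : R -> \bar R) : measurable_fun setT f ->
  (forall x, 0 <= f x) -> \int[N]_x f (- x)%R = \int[N]_x f x.
Proof.
move=> mf f0.
have mphi := measurable_normal_pdf (0:R) 1.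
rewrite ge0_integral_normal//; last exact: measurableT_comp mf _.
rewrite ge0_integral_normal//.
rewrite -(ge0_integral_opp (fun x => (phi x)%:E * f x)).
- by apply: eq_integral => x _; rewrite !standard_normal_pdfE sqrrN.
- by apply: emeasurable_funM => //; exact/measurable_EFinP.
- by move=> x; rewrite mule_ge0// lee_fin normal_pdf_ge0.
Qed.

Lemma normal_prob_opp (B : set R) : measurable B -> N (-%R @^-1` B) = N B.
Proof.
move=> mB.
have mNB : measurable (-%R @^-1` B : set R).
  by rewrite -[X in measurable X]setTI; exact: (@oppr_measurable R setT).
have mi : measurable_fun [set: R] (fun x => (\1_B x : R)%:E).
  by apply/measurable_EFinP; exact: measurable_indic.
have := ge0_integral_normal_opp (fun x => (\1_B x : R)%:E) mi (fun x => ltac:(by rewrite lee_fin)).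
rewrite [RHS]integral_indic// setIT => <-.
by rewrite -[in LHS](setIT (_ @^-1` _)) -integral_indic.
Qed.
End plane.

(** * The laws of the Gaussian pair and of the signed normal variable *)

Section gaussian_pair.
Context {d} {T : measurableType d} {R : realType} (P : probability T R).
Local Notation N := (normal_prob (0 : R) 1).

(** The first row of [A] is [r *: u] with [u] a unit vector; let [v] be the
orthogonal unit vector. The second row is then [- mu *: u + e *: v] with
[e ^ 2 = a ^ 2], so that the pair is [(r p, - mu p + e q)] where [(p, q)], the
coordinates of the normal vector in the basis [(u, v)], is again standard
normal by rotation invariance. A reflection of [q] adjusts the sign of [e].
Nothing is divided by [a], so singular covariance matrices are covered. *)
Lemma ge0_integral_gaussian_pair (Q1 Q2 : {RV P >-> R}) (S : 'M[R]_2)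
    (r mu a : R) (f : R * R -> \bar R) :
  0 < r -> S ord0 ord0 = r ^+ 2 -> S ord0 ord_max = - (mu * r) ->
  S ord_max ord_max = mu ^+ 2 + a ^+ 2 ->
  centered_gaussian_pair Q1 Q2 S ->
  measurable_fun setT f -> (forall z, (0 <= f z)%E) ->
  (\int[P]_w f (Q1 w, Q2 w) =
   \int[N \x N]_z f (r * z.1, - (mu * z.1) - a * z.2)%R)%E.
Proof.
move=> r0 S00 S01 S11 [A [AA law]] mf f0.
have r0' : r != 0 by rewrite gt_eqF.
have AE i j : (A *m A^T) i j =
    A i ord0 * A j ord0 + A i ord_max * A j ord_max.
  rewrite mxE big_ord_recl big_ord1 !mxE.
  by rewrite (_ : lift ord0 ord0 = ord_max)//; exact: val_inj.
rewrite -AA !AE in S00 S01 S11; move: law S00 S01 S11.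
set a00 := A ord0 ord0; set a01 := A ord0 ord_max.
set a10 := A ord_max ord0; set a11 := A ord_max ord_max => law S00 S01 S11.
have mlin (u v : R) : measurable_fun setT (fun z : R * R => u * z.1 + v * z.2).
  by apply: measurable_funD => //; apply: measurable_funM.
have mlin2 (u v u' v' : R) : measurable_fun setT
    (fun z : R * R => (u * z.1 + v * z.2, u' * z.1 + v' * z.2)).
  by apply: measurable_fun_pair; exact: mlin.
have mQ : measurable_fun setT (fun w => (Q1 w, Q2 w)) by exact: measurable_fun_pair.
rewrite (ge0_integral_same_law P (N \x N)%E _ _ f mQ
  (mlin2 a00 a01 a10 a11) law mf f0).
(* [u = (c, - s)] and [v = (s, c)]: the rotation of parameters [c] and [s] maps a
   vector to its coordinates in this basis. *)
pose c := a00 / r; pose s := - a01 / r; pose e := s * a10 + c * a11.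
have cs : c ^+ 2 + s ^+ 2 = 1.
  rewrite /c /s !exprMn sqrrN -mulrDl !expr2 S00 -expr2 -exprMn divff//.
  by rewrite expr1n.
have mu_E : c * a10 - s * a11 = - mu.
  by apply: (mulfI r0'); rewrite /c /s; transitivity (a00 * a10 + a01 * a11);
    [field|rewrite S01; ring].
have e2 : e ^+ 2 = a ^+ 2.
  have : (c * a10 - s * a11) ^+ 2 + e ^+ 2 =
      (c ^+ 2 + s ^+ 2) * (a10 * a10 + a11 * a11) by rewrite /e; ring.
  by rewrite mu_E cs S11; lra.
have a10E : a10 = - (mu * c) + e * s.
  transitivity ((c ^+ 2 + s ^+ 2) * a10); first by rewrite cs mul1r.
  by rewrite /e; have := mu_E; nra.
have a11E : a11 = mu * s + e * c.
  transitivity ((c ^+ 2 + s ^+ 2) * a11); first by rewrite cs mul1r.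
  by rewrite /e; have := mu_E; nra.
pose h (b : R) z := f (r * z.1, - (mu * z.1) - b * z.2)%R.
have mh b : measurable_fun setT (h b).
  apply: measurableT_comp mf _; apply: measurable_fun_pair.
    exact: measurable_funM.
  by under eq_fun do rewrite -!mulNr; exact: mlin.
transitivity (\int[N \x N]_z h (- e)%R z)%E.
  rewrite -(ge0_integral_normal2_rotation (h (- e)) c s (mh _) (fun z => f0 _) cs).
  apply: eq_integral => -[x y] _; rewrite /h/=; congr (f (_, _)).
    by rewrite /c /s; field.
  by rewrite a10E a11E; ring.
have : (e == a) || (e == - a) by rewrite -eqf_sqr e2.
case/orP => /eqP ->; last by rewrite opprK.
rewrite -(ge0_integral_normal2_reflect (h (- a)) (mh _) (fun z => f0 _)).
by apply: eq_integral => -[x y] _; rewrite /h/=; congr (f (_, _)); ring.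
Qed.

(** The product lies in [B] when [Z1] does and [Y = 1], or when [- Z1] does and
[Y = -1]. The second event contributes [1 - p (- x)] after reflecting the normal
law, which is [p x] again. *)
Lemma sign_tilted_normal (Z1 Y : {RV P >-> R}) (p : R -> R) (B : set R) :
  measurable_fun setT p -> (forall x, 0 <= p x) -> (forall x, p (- x) = 1 - p x) ->
  standard_normal Z1 -> cond_sign_law Z1 Y p -> measurable B ->
  P [set w | B (Z1 w * Y w)] = (\int[N]_(x in B) (2 * p x)%:E)%E.
Proof.
move=> mp p0 pN nZ1 law mB.
have p1 x : 0 <= 1 - p x by rewrite -pN.
have mY1 (y : R) : measurable (Y @^-1` [set y]).
  by rewrite -[X in measurable X]setTI; exact: measurable_funP.
have mpE : measurable_fun setT (fun x => (p x)%:E) by exact/measurable_EFinP.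
have mpE1 : measurable_fun setT (fun x => (1 - p x)%:E).
  by apply/measurable_EFinP; exact: measurable_funB.
(* Almost surely [Y] is a sign: the two conditional probabilities sum to 1. *)
pose U : set T := Y @^-1` [set 1] `|` Y @^-1` [set -1].
have disj (A A' : set T) :
    (A `&` Y @^-1` [set 1]) `&` (A' `&` Y @^-1` [set -1]) = set0.
  apply/seteqP; split => // w [[_ /= ->] [_ /= h]].
  by have : (1 : R) = -1 := h; lra.
have mU : measurable U by exact: measurableU.
have PU : P U = 1%E.
  have [l1 l2] := law setT measurableT.
  rewrite preimage_setT !setTI in l1 l2.
  transitivity (P (Y @^-1` [set 1%R]) + P (Y @^-1` [set (-1)%R]))%E.
    apply: measureU => //.
    by rewrite -(setTI (Y @^-1` [set 1])) -(setTI (Y @^-1` [set -1])); exact: disj.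
  rewrite l1 l2.
  rewrite -ge0_integralD//.
  - under eq_integral do rewrite -EFinD addrC subrK.
    by rewrite integral_cst// mul1e; exact: probability_setT.
  - by move=> w _; rewrite lee_fin.
  - exact: measurableT_comp mpE _.
  - by move=> w _; rewrite lee_fin.
  - exact: measurableT_comp mpE1 _.
pose V w := Z1 w * Y w.
have mV : measurable_fun setT V by exact: measurable_funM.
have mVB : measurable (V @^-1` B) by rewrite -[X in measurable X]setTI; exact: mV.
have -> : P [set w | B (Z1 w * Y w)] = P ((V @^-1` B) `&` U).
  rewrite -[LHS]/(P (V @^-1` B)) [LHS](measureDI P mVB mU).
  rewrite [X in (X + _)%E](_ : _ = 0%E) ?add0e//.
  apply: (subset_measure0 (B := ~` U)) => //.
  - exact: measurableD.
  - exact: measurableC.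
  - by transitivity (1 - P U)%E; [exact: probability_setC|rewrite PU subee].
have mNB : measurable (-%R @^-1` B : set R).
  by rewrite -[X in measurable X]setTI; exact: (@oppr_measurable R setT).
have -> : V @^-1` B `&` U = (Z1 @^-1` B `&` Y @^-1` [set 1])
   `|` (Z1 @^-1` (-%R @^-1` B) `&` Y @^-1` [set -1]).
  apply/seteqP; split => w /=; rewrite /V.
    by move=> [+ [] /= h]; rewrite h ?mulr1 ?mulrN1 => ?; [left|right].
  by move=> [] [BV /= h]; rewrite h ?mulr1 ?mulrN1; split=> //;
    rewrite /U/= h; auto.
have mZ (C : set R) : measurable C -> measurable (Z1 @^-1` C).
  by move=> mC; rewrite -[X in measurable X]setTI; exact: measurable_funP.
transitivity (P (Z1 @^-1` B `&` Y @^-1` [set 1%R]) +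
    P (Z1 @^-1` (-%R @^-1` B) `&` Y @^-1` [set (-1)%R]))%E.
  by apply: measureU; [exact: measurableI (mZ _ mB) (mY1 _)|
    exact: measurableI (mZ _ mNB) (mY1 _)|exact: disj].
have [-> _] := law B mB; have [_ ->] := law _ mNB.
have mid : measurable_fun [set: R] (id : R -> R) by [].
have mopp : measurable_fun [set: R] (-%R : R -> R) by exact: oppr_measurable.
rewrite (ge0_integral_same_law_in P N Z1 id B (fun x => (p x)%:E) _ mid mB nZ1 mpE)//.
have nZ1N C : measurable C -> P (Z1 @^-1` C) = N (-%R @^-1` C).
  by move=> mC; rewrite normal_prob_opp//; exact: nZ1.
rewrite (ge0_integral_same_law_in P N Z1 -%R (-%R @^-1` B)
  (fun x => (1 - p x)%:E) _ mopp mNB nZ1N mpE1)//.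
rewrite preimage_id (_ : -%R @^-1` (-%R @^-1` B) = B); last first.
  by apply/seteqP; split => x /=; rewrite opprK.
rewrite -ge0_integralD//.
- apply: eq_integral => x _; rewrite pN -EFinD; congr EFin; lra.
- by move=> w _; rewrite lee_fin.
- exact: measurable_funTS.
- by move=> w _; rewrite lee_fin.
- by apply: measurable_funTS; exact: measurableT_comp mpE1 _.
Qed.

End gaussian_pair.

Section joint.
Context {d} {T : measurableType d} {R : realType} (P : probability T R).
Local Notation N := (normal_prob (0 : R) 1).
Local Open Scope ereal_scope.

(** By independence the law of [(V, Z)] is the product of the marginal laws;
Tonelli's theorem then allows the density of [V] to be inserted in the outer
integral. *)
Lemma ge0_integral_indep_pair (V Z : {RV P >-> R}) (w : R -> R)
    (f : R * R -> \bar R) :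
  measurable_fun setT w -> (forall x, (0 <= w x)%R) ->
  (forall B, measurable B -> P (V @^-1` B) = \int[N]_(x in B) (w x)%:E) ->
  standard_normal Z ->
  (forall B C, measurable B -> measurable C ->
    P (V @^-1` B `&` Z @^-1` C) = P (V @^-1` B) * P (Z @^-1` C)) ->
  measurable_fun setT f -> (forall z, 0 <= f z) ->
  \int[P]_t f (V t, Z t) = \int[N \x N]_z ((w z.1)%:E * f z).
Proof.
move=> mw w0 lawV lawZ ind mf f0.
have mVZ : measurable_fun setT (fun t => (V t, Z t)).
  by apply: measurable_fun_pair.
pose nuV : probability R R := distribution P V.
pose nuZ : probability R R := distribution P Z.
pose VZ t := (V t, Z t).
have law B : measurable B -> P (VZ @^-1` B) = (nuV \x nuZ) B.
  move=> mB; apply/esym.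
  have U := @product_measure_unique _ _ R R R nuV nuZ (pushforward P VZ).
  by apply: U => // A C; exact: ind.
rewrite (ge0_integral_same_law P (nuV \x nuZ) VZ id f mVZ _ law mf f0)//.
rewrite fubini_tonelli1// (_ : fubini_F nuZ f = fubini_F N f); last first.
  apply/funext => x.
  apply: (ge0_integral_same_law nuZ N id id (fun y => f (x, y))) => //.
  exact: measurableT_comp mf (measurable_pair1 x).
have mF : measurable_fun setT (fubini_F N f).
  exact: measurable_fun_fubini_tonelli_F.
have F0 x : 0 <= fubini_F N f x by apply: integral_ge0.
rewrite (ge0_integral_law_density nuV N id w _ _ mw w0 lawV mF F0)//.
rewrite fubini_tonelli1//; last 2 first.
- apply: emeasurable_funM => //; apply/measurable_EFinP.
  exact: measurableT_comp.
- by move=> z; rewrite mule_ge0// lee_fin.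
apply: eq_integral => x _; rewrite /fubini_F/= -ge0_integralZl//.
- exact: measurableT_comp mf (measurable_pair1 x).
- by rewrite lee_fin.
Qed.

End joint.

(** * The change of measure *)

Section reweighting.
Context {R : realType} {d1} {T1 : measurableType d1} (P1 : probability T1 R)
  {d2} {T2 : measurableType d2} (P2 : probability T2 R).
Local Notation N := (normal_prob (0 : R) 1).

(** Both sides are the integral of [2 * rho' (r x) * G (x, - mu x - alpha2 y)]
against the standard normal law of [(x, y)]. The identity holds for an arbitrary
measurable [G], integrable or not, because positive and negative parts can be
treated separately. *)
Lemma expectation_reweighting (kappa r alpha1 sigma alpha2 mu : R)
    (Q1 Q2 : {RV P1 >-> R}) (Z Z1 Y : {RV P2 >-> R}) (G : R * R -> R) :
  0 < kappa -> 0 < r ->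
  centered_gaussian_pair Q1 Q2 (LOO_cov kappa r alpha1 sigma) ->
  standard_normal Z -> standard_normal Z1 -> indep_of_pair Z1 Y Z ->
  cond_sign_law Z1 Y (fun z => derive1 rho (r * z)) ->
  alpha1 = alpha2 / Num.sqrt kappa -> sigma = mu / r ->
  measurable_fun setT G ->
  ('E_P1[fun w => (2 * derive1 rho (Q1 w) * G (Q1 w / r, Q2 w))%R] =
  'E_P2[fun w => (G (Z1 w * Y w, - (alpha2 * Z w + mu * (Z1 w * Y w))))%R])%E.
Proof.
move=> k0 r0 gQ nZ nZ1 ind law a1E sE mG.
have r0' : r != 0 by rewrite gt_eqF.
pose p (z : R) : R := derive1 rho (r * z).
have mp : measurable_fun setT p.
  by apply: measurableT_comp; [exact: measurable_derive1_rho|exact: measurable_funM].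
have p0 z : 0 <= p z by exact: derive1_rho_ge0.
have pN z : p (- z) = 1 - p z by rewrite /p mulrN derive1_rhoN.
have two_rho_ge0 x : 0 <= 2 * derive1 (@rho R) x.
  exact: mulr_ge0 (ler0n R 2) (derive1_rho_ge0 x).
have m2rho : measurable_fun setT (fun x => 2 * derive1 (@rho R) x).
  exact: measurable_funM (measurable_cst (2 : R)) measurable_derive1_rho.
have ge0_reweighting (g : R * R -> \bar R) :
    measurable_fun setT g -> (forall z, (0 <= g z)%E) ->
    (\int[P1]_w ((2 * derive1 rho (Q1 w))%:E * g (Q1 w / r, Q2 w)%R) =
     \int[P2]_w g (Z1 w * Y w, - (alpha2 * Z w + mu * (Z1 w * Y w)))%R)%E.
  move=> mg g0.
  pose f (z : R * R) := ((2 * derive1 rho z.1)%:E * g (z.1 / r, z.2)%R)%E.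
  have mf : measurable_fun setT f.
    apply: emeasurable_funM.
      by apply/measurable_EFinP; apply: (measurableT_comp m2rho).
    apply: measurableT_comp mg _; apply: measurable_fun_pair => //.
    exact: measurable_funM.
  have f0 z : (0 <= f z)%E.
    by apply: mule_ge0; [rewrite lee_fin; exact: two_rho_ge0|exact: g0].
  rewrite (ge0_integral_gaussian_pair P1 Q1 Q2 _ r mu alpha2 f r0 _ _ _ gQ mf f0);
    first last.
  - rewrite !mxE/= sE a1E !exprMn !exprVn sqr_sqrtr ?ltW//.
    by field; rewrite r0' gt_eqF.
  - by rewrite !mxE/= sE; field.
  - by rewrite !mxE.
  have mV : measurable_fun setT (fun w => Z1 w * Y w) by exact: measurable_funM.
  pose V : {RV P2 >-> R} := HB.pack (fun w => Z1 w * Y w)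
    (isMeasurableFun.Build _ _ _ _ _ mV).
  pose h (z : R * R) := g (z.1, - (alpha2 * z.2 + mu * z.1))%R.
  have mh : measurable_fun setT h.
    apply: measurableT_comp mg _; apply: measurable_fun_pair => //.
    apply: measurableT_comp => //.
    by apply: measurable_funD => //; apply: measurable_funM.
  have lawV B : measurable B -> P2 (V @^-1` B) = (\int[N]_(x in B) (2 * p x)%:E)%E.
    by move=> mB; exact: (sign_tilted_normal P2 Z1 Y p B).
  have mulV B : measurable B -> measurable [set z : R * R | B (z.1 * z.2)].
    move=> mB; rewrite -[X in measurable X]setTI.
    have := @measurable_funM _ (R * R)%type R setT fst snd.
    by apply.
  have := ge0_integral_indep_pair P2 V Z (fun x => 2 * p x) h _ _ lawV nZ _ mh (fun z => g0 _).
  rewrite /h/= => ->.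
  - apply: eq_integral => -[x y] _; rewrite /f/= /p; congr (_ * g (_, _))%E.
      by field.
    by ring.
  - exact: measurable_funM.
  - by move=> x; rewrite mulr_ge0.
  - move=> B C mB mC; exact: (ind _ C (mulV B mB) mC).
rewrite unlock integralE [RHS]integralE.
have mE : measurable_fun setT (EFin \o G) by exact/measurable_EFinP.
have w0 w : (0 <= (2 * derive1 rho (Q1 w))%:E)%E.
  by rewrite lee_fin; exact: two_rho_ge0.
have Hp := ge0_reweighting ((EFin \o G)^\+)%E (measurable_funepos mE) (funepos_ge0 _).
have Hn := ge0_reweighting ((EFin \o G)^\-)%E (measurable_funeneg mE) (funeneg_ge0 _).
rewrite funepos.unlock in Hp *; rewrite funeneg.unlock in Hn *.
congr (_ - _)%E.
- apply: etrans Hp; apply: eq_integral => w _.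
  by rewrite EFinM maxe_pMr ?mule0.
- apply: etrans Hn; apply: eq_integral => w _.
  by rewrite EFinM -muleN maxe_pMr ?mule0.
Qed.

End reweighting.

(** * Equivalence of the equations *)

Section scaling.
Context {d} {T : measurableType d} {R : realType} (P : probability T R).

(** A measurable function whose integral is [0] is integrable: the integrals of
its positive and negative parts are then equal and finite. Hence the constant can
be moved out of the expectation without assuming integrability. *)
Lemma eq0_expectationZ_imp (f : T -> R) (c : R) : measurable_fun setT f ->
  (0%E = 'E_P[f] -> 0%E = 'E_P[fun w => (c * f w)%R])%E.
Proof.
move=> mf E0; have mfE : measurable_fun setT (EFin \o f) by exact/measurable_EFinP.
suff fi : P.-integrable setT (EFin \o f).
  have Zl := integralZl measurableT fi c.
  rewrite unlock in E0 *; apply/esym; apply: etrans Zl _.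
  by rewrite -[X in (_ * X)%E]E0 mule0.
apply/integrableP; split => //.
move: E0; rewrite unlock integralE.
have p0 : (0 <= \int[P]_x (EFin \o f)^\+ x)%E.
  by apply: integral_ge0 => x _; exact: funepos_ge0.
have n0 : (0 <= \int[P]_x (EFin \o f)^\- x)%E.
  by apply: integral_ge0 => x _; exact: funeneg_ge0.
rewrite (_ : (\int[P]_x `|(EFin \o f) x|)%E =
  (\int[P]_x (EFin \o f)^\+ x + \int[P]_x (EFin \o f)^\- x)%E).
  move: p0 n0; case: (integral P setT _) => [a| |] //;
    case: (integral P setT _) => [b| |] //.
  by rewrite -EFinD ltry.
rewrite -ge0_integralD//; last 2 first.
- exact: measurable_funepos.
- exact: measurable_funeneg.
by apply: eq_integral => x _; rewrite -/((abse \o (EFin \o f)) x) fune_abse.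
Qed.

Lemma eq0_expectationZ (f : T -> R) (c : R) : measurable_fun setT f ->
  c != 0 -> (0%E = 'E_P[f] <-> 0%E = 'E_P[fun w => (c * f w)%R])%E.
Proof.
move=> mf c0; split; first exact: eq0_expectationZ_imp.
have mcf : measurable_fun setT (fun w => c * f w) by exact: measurable_funM.
move=> /(eq0_expectationZ_imp _ c^-1 mcf).
by under [X in expectation _ X]eq_fun do rewrite mulKf//.
Qed.

Lemma ge0_expectationZ (f : T -> R) (c : R) : measurable_fun setT f ->
  (forall w, 0 <= f w) -> 0 <= c ->
  ('E_P[fun w => (c * f w)%R] = c%:E * 'E_P[f])%E.
Proof.
move=> mf f0 c0; rewrite unlock; under eq_integral do rewrite EFinM.
rewrite ge0_integralZl//; first exact/measurable_EFinP.
by move=> w _; rewrite lee_fin.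
Qed.

Lemma ge0_expectationD (f g : T -> R) : measurable_fun setT f ->
  measurable_fun setT g -> (forall w, 0 <= f w) -> (forall w, 0 <= g w) ->
  ('E_P[fun w => (f w + g w)%R] = 'E_P[f] + 'E_P[g])%E.
Proof.
move=> mf mg f0 g0; rewrite unlock; under eq_integral do rewrite EFinD.
rewrite ge0_integralD//; [by move=> w _; rewrite lee_fin|exact/measurable_EFinP|
  by move=> w _; rewrite lee_fin|exact/measurable_EFinP].
Qed.

(** The expectations of [1 / (1 + lambda b)] and [lambda b / (1 + lambda b)] are
nonnegative and sum to 1, hence finite. *)
Lemma expectation_resolvent (b : T -> R) (lambda kappa : R) :
  measurable_fun setT b -> (forall w, 0 <= b w) -> 0 < lambda ->
  ((1 - kappa)%:E = 'E_P[fun w => (1 + lambda * b w)^-1%R] <->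
   kappa%:E = lambda%:E * 'E_P[fun w => (b w / (1 + lambda * b w))%R])%E.
Proof.
move=> mb b0 l0.
have p w : 0 < 1 + lambda * b w.
  by rewrite ltr_pwDl// mulr_ge0// ltW.
have mi : measurable_fun setT (fun w => (1 + lambda * b w)^-1).
  by apply: measurable_onepV; [exact: measurable_funM|move=> w; rewrite mulr_ge0// ltW].
have mbi : measurable_fun setT (fun w => b w / (1 + lambda * b w)).
  exact: measurable_funM.
have i0 w : 0 <= (1 + lambda * b w)^-1 by rewrite invr_ge0 ltW.
have bi0 w : 0 <= b w / (1 + lambda * b w) by rewrite mulr_ge0.
rewrite -ge0_expectationZ// ?ltW//.
have : ('E_P[fun w => (1 + lambda * b w)^-1%R] +
        'E_P[fun w => (lambda * (b w / (1 + lambda * b w)))%R] = 1)%E.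
  rewrite -ge0_expectationD//.
  - rewrite -[RHS](expectation_cst P 1); congr (expectation P _).
    apply/funext => w /=; field; exact: lt0r_neq0.
  - exact: measurable_funM.
  - by move=> w; rewrite mulr_ge0// ltW.
have := @expectation_ge0 _ _ _ P _ i0.
have : (0 <= 'E_P[fun w => (lambda * (b w / (1 + lambda * b w)))%R])%E.
  by apply: expectation_ge0 => w; rewrite mulr_ge0// ltW.
case: (expectation P _) => [x| |]//; case: (expectation P _) => [y| |]//.
by move=> _ _ [] xy; split => -[h]; congr EFin; lra.
Qed.
End scaling.

Lemma EFin_eq_mulVl {R : realType} (a b c : R) (x : \bar R) : c != 0 -> b = c * a ->
  (a%:E = c^-1%:E * x)%E <-> b%:E = x.
Proof.
move=> c0 ->; split => [h|<-]; last by rewrite -EFinM mulKf.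
by rewrite EFinM h muleA -EFinM divff// mul1e.
Qed.

(** The equivalence uses only the reweighting identity and the sign of [b]; the
functions [s], [b] and [h] are to be the first and second derivatives of [rho]
and its proximal operator. Each equation follows from one choice of [G]. *)
Lemma equations_equiv {R : realType} {d1} {T1 : measurableType d1}
    (P1 : probability T1 R) {d2} {T2 : measurableType d2}
    (P2 : probability T2 R) (Q1 Q2 : T1 -> R) (V X : T2 -> R) (s b h : R -> R)
    (kappa r lambda alpha1 alpha2 : R) :
  kappa != 0 -> 0 < r -> 0 < lambda ->
  alpha2 ^+ 2 * kappa = kappa ^+ 2 * alpha1 ^+ 2 ->
  measurable_fun setT V -> measurable_fun setT X ->
  measurable_fun setT s -> measurable_fun setT b -> measurable_fun setT h ->
  (forall x, 0 <= b x) ->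
  (forall G : R * R -> R, measurable_fun setT G ->
    'E_P1[fun w => (2 * s (Q1 w) * G (Q1 w / r, Q2 w))%R] =
    'E_P2[fun w => G (V w, X w)])%E ->
  [/\ (alpha1 ^+ 2)%:E = ((kappa ^+ 2)^-1%:E *
        'E_P1[fun w => (2 * s (Q1 w) * (lambda * s (h (Q2 w))) ^+ 2)%R])%E,
      0%E = 'E_P1[fun w => (s (Q1 w) * Q1 w * (lambda * s (h (Q2 w))))%R]%E
    & (1 - kappa)%:E =
        'E_P1[fun w => (2 * s (Q1 w) / (1 + lambda * b (h (Q2 w))))%R]%E] <->
  [/\ 0%E = 'E_P2[fun w => (V w * - s (h (X w)))%R]%E,
      (alpha2 ^+ 2 * kappa)%:E =
        ((lambda ^+ 2)%:E * 'E_P2[fun w => ((- s (h (X w))) ^+ 2)%R])%E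
    & kappa%:E = (lambda%:E *
        'E_P2[fun w => (b (h (X w)) / (1 + lambda * b (h (X w))))%R])%E].
Proof.
move=> k0 r0 l0 a1k mV mX ms mb mh b0 reweight.
have r0' : r != 0 by rewrite gt_eqF.
have mbX : measurable_fun setT (fun w => b (h (X w))).
  exact: measurableT_comp mb (measurableT_comp mh mX).
have msX : measurable_fun setT (fun w => - s (h (X w))).
  by apply: measurableT_comp => //; exact: measurableT_comp ms (measurableT_comp mh mX).
have mh2 : measurable_fun setT (fun z : R * R => h z.2).
  exact: measurableT_comp mh _.
have E1 : ('E_P1[fun w => (2 * s (Q1 w) * (lambda * s (h (Q2 w))) ^+ 2)%R] =
    (lambda ^+ 2)%:E * 'E_P2[fun w => ((- s (h (X w))) ^+ 2)%R])%E.
  rewrite (reweight (fun z => (lambda * s (h z.2)) ^+ 2)); last first.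
    apply: measurable_funX; apply: measurable_funM => //.
    exact: measurableT_comp ms mh2.
  rewrite -ge0_expectationZ ?sqr_ge0//.
  - by congr (expectation _ _); apply/funext => w; rewrite exprMn sqrrN.
  - exact: measurable_funX.
  - by move=> w; exact: sqr_ge0.
have E2 : ('E_P1[fun w => (s (Q1 w) * Q1 w * (lambda * s (h (Q2 w))))%R] =
    'E_P2[fun w => (- (r * lambda / 2) * (V w * - s (h (X w))))%R])%E.
  (* This equation has the weight [s] instead of [2 * s], and the factor [Q1]
     instead of [Q1 / r]; hence the constant [r / 2]. *)
  pose G (z : R * R) := r / 2 * z.1 * (lambda * s (h z.2)).
  have mG : measurable_fun setT G.
    apply: measurable_funM; first exact: measurable_funM.
    by apply: measurable_funM => //; exact: measurableT_comp ms mh2.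
  have -> : (fun w => s (Q1 w) * Q1 w * (lambda * s (h (Q2 w)))) =
      (fun w => 2 * s (Q1 w) * G (Q1 w / r, Q2 w)).
    by apply/funext => w; rewrite /G/=; field.
  rewrite (reweight G mG); congr (expectation _ _); apply/funext => w.
  by rewrite /G/=; field.
have E3 : ('E_P1[fun w => (2 * s (Q1 w) / (1 + lambda * b (h (Q2 w))))%R] =
    'E_P2[fun w => (1 + lambda * b (h (X w)))^-1%R])%E.
  rewrite (reweight (fun z => (1 + lambda * b (h z.2))^-1))//.
  apply: measurable_onepV => [|z]; last by rewrite mulr_ge0// ltW.
  by apply: measurable_funM => //; exact: measurableT_comp mb mh2.
rewrite E1 E2 E3.
have c0 : - (r * lambda / 2) != 0.
  by rewrite oppr_eq0 !mulf_neq0 ?invr_eq0 ?gt_eqF.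
have R1 x := EFin_eq_mulVl _ _ _ x (expf_neq0 2 k0) a1k.
have R2 := eq0_expectationZ P2 _ _ (measurable_funM mV msX) c0.
have R3 := expectation_resolvent P2 _ lambda kappa mbX (fun w => b0 _) l0.
by split => -[H1 H2 H3]; split; [exact/R2|exact/R1|exact/R3|
  exact/R1|exact/R2|exact/R3].
Qed.

Theorem theorem3 (R : realType) (kappa r : R)
    (lambda1 alpha1 sigma lambda2 alpha2 mu : R)
    (d1 : measure_display) (T1 : measurableType d1) (P1 : probability T1 R)
    (Q1 Q2 : {RV P1 >-> R})
    (d2 : measure_display) (T2 : measurableType d2) (P2 : probability T2 R)
    (Z Z1 Y : {RV P2 >-> R}) :
  0 < kappa -> 0 < r ->
  centered_gaussian_pair Q1 Q2 (LOO_cov kappa r alpha1 sigma) ->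
  standard_normal Z -> standard_normal Z1 ->
  indep_of_pair Z1 Y Z ->
  cond_sign_law Z1 Y (fun z => derive1 rho (r * z)) ->
  alpha1 = alpha2 / Num.sqrt kappa -> sigma = mu / r -> lambda1 = lambda2 ->
  LOO_system Q1 Q2 kappa lambda1 alpha1 <->
  CGMT_system P2 Z (fun w => Z1 w * Y w) kappa lambda2 alpha2 mu.
Proof.
move=> k0 r0 gQ nZ nZ1 ind law a1E sE ->; move: lambda2 => lambda.
rewrite /LOO_system /CGMT_system.
(* Both systems include [0 < lambda], without which the proximal operators are
   meaningless. *)
have [l0|l0] := ltP 0 lambda; last by split => -[].
pose V w := Z1 w * Y w.
pose X w := - (alpha2 * Z w + mu * V w).
have mV : measurable_fun setT V by exact: measurable_funM.
have mX : measurable_fun setT X.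
  apply: measurableT_comp => //.
  by apply: measurable_funD; apply: measurable_funM.
have a1k : alpha2 ^+ 2 * kappa = kappa ^+ 2 * alpha1 ^+ 2.
  rewrite a1E expr_div_n sqr_sqrtr ?ltW//; field; exact: lt0r_neq0.
have ell1 w : derive1 ell (prox ell (alpha2 * Z w + mu * (Z1 w * Y w)) lambda) =
    - derive1 rho (prox rho (X w) lambda).
  by rewrite (prox_ell _ _ l0) derive1_ell opprK.
have ell2 w : derive1n 2 ell
    (prox ell (alpha2 * Z w + mu * (Z1 w * Y w)) lambda) =
    derive1n 2 rho (prox rho (X w) lambda).
  by rewrite (prox_ell _ _ l0) derive2_ell opprK.
have core := equations_equiv P1 P2 Q1 Q2 V X (derive1 rho) (derive1n 2 rho)
  (fun x => prox rho x lambda) kappa r lambda alpha1 alpha2 (lt0r_neq0 k0) r0 l0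
  a1k mV mX measurable_derive1_rho measurable_derive2_rho
  (measurable_prox_rho lambda l0) derive2_rho_ge0
  (fun G => expectation_reweighting P1 P2 kappa r alpha1 sigma alpha2 mu Q1 Q2 Z Z1 Y
     G k0 r0 gQ nZ nZ1 ind law a1E sE).
have -> : (fun w => Z1 w * Y w * derive1 ell
    (prox ell (alpha2 * Z w + mu * (Z1 w * Y w)) lambda)) =
    (fun w => V w * - derive1 rho (prox rho (X w) lambda)).
  by apply/funext => w; rewrite ell1.
have -> : (fun w => derive1 ell
    (prox ell (alpha2 * Z w + mu * (Z1 w * Y w)) lambda) ^+ 2) =
    (fun w => (- derive1 rho (prox rho (X w) lambda)) ^+ 2).
  by apply/funext => w; rewrite ell1.
have -> : (fun w => derive1n 2 ell
    (prox ell (alpha2 * Z w + mu * (Z1 w * Y w)) lambda) /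
    (1 + lambda * derive1n 2 ell
      (prox ell (alpha2 * Z w + mu * (Z1 w * Y w)) lambda))) =
    (fun w => derive1n 2 rho (prox rho (X w) lambda) /
      (1 + lambda * derive1n 2 rho (prox rho (X w) lambda))).
  by apply/funext => w; rewrite ell2.
split => -[_ H1 H2 H3].
- by have [] := core.1 (And3 H1 H2 H3).
- by have [] := core.2 (And3 H1 H2 H3).
Qed.
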